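(* Assume $\Omega_{\mathrm O}$ and $\Omega_{\mathrm I}$ satisfy the standing assumptions (1)–(5). Then for every $\psi\in\boldsymbol{A}^{\circ}_\Omega$ one has $\langle\psi\rangle_{\mathbb T}\notin\operatorname{int}\operatorname{conv}\Omega_{\mathrm I}$.
   Context: Let $d\ge1$. $\Omega_{\mathrm O}\subset\mathbb R^d$ is a nonempty open strictly convex set and $\Omega_{\mathrm I}\subset\Omega_{\mathrm O}$ is a closed set; $\operatorname{conv}$, $\operatorname{int}$, $\operatorname{cl}$, $\partial$ denote convex hull, interior, closure, boundary. A ray is a set $\{x+te: t\ge0\}$ with $e\ne0$. The standing assumptions are: (1) $\partial\operatorname{conv}\Omega_{\mathrm I}$ contains no rays; (2) $\operatorname{cl}\operatorname{conv}\Omega_{\mathrm I}\subset\Omega_{\mathrm O}$; (3) $\operatorname{int}\operatorname{conv}\Omega_{\mathrm I}\ne\varnothing$ and $\Omega_{\mathrm O}$ and $\operatorname{conv}\Omega_{\mathrm I}$ have congruent maximal inscribed cones (the set of directions $e$ such that some ray $\{x+te:t\ge0\}$ is contained in the set is the same for both sets); (4) the set $(\operatorname{int}\operatorname{conv}\Omega_{\mathrm I})\setminus\Omega_{\mathrm I}$ is a locally finite union of its connected components $\omega_j$ (every bounded subset of $\mathbb R^d$ meets only finitely many $\omega_j$); (5) for every $j$ there is a supporting hyperplane $L_j$ to $\operatorname{conv}\Omega_{\mathrm I}$ that contains $E_j:=\partial\omega_j\setminus\Omega_{\mathrm I}$. Set $\Omega=\operatorname{cl}\Omega_{\mathrm O}\setminus\Omega_{\mathrm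 I}$. For a Borel set $E$ of finite positive measure and an $\mathbb R^d$-valued summable function $\psi$, $\langle\psi\rangle_E=|E|^{-1}\int_E\psi$ (coordinate-wise). $\mathbb T=\mathbb R/\mathbb Z$; a function $\psi$ on $\mathbb T$ is identified with its $1$-periodic version $\psi_{\mathrm{per}}$ on $\mathbb R$, and $\langle\psi\rangle_{\mathbb T}=\int_0^1\psi_{\mathrm{per}}$. Define $\boldsymbol{A}^{\circ}_\Omega=\{\psi\in L_1(\mathbb T,\mathbb R^d): \psi(x)\in\partial\Omega_{\mathrm O}\ \forall x\in\mathbb T,\ \langle\psi_{\mathrm{per}}\rangle_J\notin\Omega_{\mathrm I}\text{ for every bounded interval }J\subset\mathbb R\}$. *)

(* Defs.v *)
From HB Require Import structures.
From mathcomp Require Import all_boot all_order all_algebra.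
From mathcomp Require Import all_classical all_reals all_analysis.
Set Implicit Arguments. Unset Strict Implicit. Unset Printing Implicit Defensive.
Import Order.TTheory GRing.Theory Num.Theory.
Import numFieldNormedType.Exports.
Local Open Scope classical_set_scope.
Local Open Scope ring_scope.

Section Defs.
Variables (R : realType) (d : nat).
Notation V := 'rV[R]_d.

Definition chull (A : set V) : set V :=
  [set x | exists (n : nat) (w : 'I_n -> R) (p : 'I_n -> V),
     [/\ forall i, 0 <= w i, \sum_(i < n) w i = 1, forall i, A (p i)
       & x = \sum_(i < n) w i *: p i]].

Definition is_convex (A : set V) : Prop :=
  forall x y (t : R), A x -> A y -> 0 <= t <= 1 -> A ((1 - t) *: x + t *: y).

Definition strictly_convex (A : set V) : Prop :=
  is_convex A /\
  forall x y (t : R), closure A x -> closure A y -> x != y -> 0 < t < 1 ->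
    A° ((1 - t) *: x + t *: y).

Definition bdry (A : set V) : set V := closure A `\` A°.

Definition ray (x e : V) : set V := [set x + t *: e | t in [set t : R | 0 <= t]].

(* directions of the maximal inscribed cone *)
Definition ray_dirs (A : set V) : set V :=
  [set e | e != 0 /\ exists x, ray x e `<=` A].

Definition dotv (a x : V) : R := \sum_(i < d) a ord0 i * x ord0 i.

Definition supporting_hyperplane (A L : set V) : Prop :=
  exists (a : V) (c : R), [/\ a != 0, L = [set x | dotv a x = c],
    A `<=` [set x | dotv a x <= c] & exists x, closure A x /\ L x].

Definition components (U : set V) : set (set V) :=
  [set C | exists2 x, U x & C = connected_component U x].

Definition standing_assumptions (OmO OmI : set V) : Prop :=
  [/\ (OmO !=set0), open OmO, strictly_convex OmO, closed OmI & OmI `<=` OmO] /\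
  [/\
    (* (1) *) (forall x e, e != 0 -> ~ (ray x e `<=` bdry (chull OmI))),
    (* (2) *) closure (chull OmI) `<=` OmO,
    (* (3) *) ((chull OmI)° !=set0 /\ ray_dirs OmO = ray_dirs (chull OmI)),
    (* (4) *) (forall B : set V, bounded_set B ->
                 finite_set [set C | components ((chull OmI)° `\` OmI) C /\ (C `&` B !=set0)])
  & (* (5) *) (forall C, components ((chull OmI)° `\` OmI) C ->
        exists L, supporting_hyperplane (chull OmI) L /\ bdry C `\` OmI `<=` L)].

Definition avg (psi : R -> V) (a b : R) : V :=
  \row_(i < d) ((b - a)^-1 * Rintegral lebesgue_measure `[a, b] (fun x => psi x ord0 i)).

Definition L1_torus (psi : R -> V) : Prop :=
  (forall x, psi (x + 1) = psi x) /\
  forall i : 'I_d, lebesgue_measure.-integrable `[0, 1] (fun x => (psi x ord0 i)%:E).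

Definition A_circ (OmO OmI : set V) : set (R -> V) :=
  [set psi | [/\ L1_torus psi, forall x, bdry OmO (psi x)
     & forall a b : R, a < b -> ~ OmI (avg psi a b)]].

End Defs.

(* Main.v *)
(** Suppose the mean [x0] of [psi] over a period lies in the interior of the
    convex hull of [OmI].  Then [x0] lies in a component [C] of that interior
    minus [OmI], and the part of the boundary of [C] outside [OmI] lies in a
    supporting hyperplane [n . x = c], while [n . x0 < c].  Put
    [F t = int_0^t (n . psi - c)]; then [F (t + 1) = F t + F 1] with [F 1 < 0],
    so some Lebesgue point [a] of [psi] satisfies [F b < F a] for all [b] in
    [(a, a + 1]].  Hence the path of means of [psi] over [[a, b]] never meets the
    hyperplane; it avoids [OmI] as well and ends at [x0] when [b = a + 1], so it
    stays in [C].  As [b] decreases to [a] it converges to [psi a], which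
    therefore lies in the closed hull of [OmI], hence in the open set [OmO],
    although [psi a] is a boundary point of [OmO]. *)

Require Import Defs.
From HB Require Import structures.
From mathcomp Require Import all_boot all_order all_algebra.
From mathcomp Require Import all_classical all_reals all_analysis.
From mathcomp Require Import measurable_realfun ring lra.
Import Order.TTheory GRing.Theory Num.Theory.
Import numFieldNormedType.Exports.
Local Open Scope classical_set_scope.
Local Open Scope ring_scope.

(** * Translation invariance of the integral *)

(** The translated measure gives every half-open interval its length, and this determines Lebesgue
    measure. *)
Lemma lebesgue_measure_shift (R : realType) (c : R) (A : set R) : measurable A ->
  pushforward lebesgue_measure ((fun x => x + c) : measurableTypeR R -> measurableTypeR R) A
  = lebesgue_measure A.
Proof.
have mphi : measurable_fun setT
  ((fun x => x + c) : measurableTypeR R -> measurableTypeR R).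
  by apply: measurable_funD.
move=> mA; apply/esym.
pose mphi_mixin := isMeasurableFun.Build _ _ _ _ _ mphi.
pose phi : {mfun _ >-> _} :=
  HB.pack ((fun x => x + c) : measurableTypeR R -> measurableTypeR R) mphi_mixin.
apply: (@lebesgue_measure_unique R (pushforward lebesgue_measure phi)) => //.
move=> _ [[a b] _ <-].
transitivity (lebesgue_measure (`]a - c, b - c]%classic : set R)).
  by rewrite /= !lebesgue_measure_itv/= !lte_fin ltrD2r -!EFinD opprB addrA subrK.
rewrite /pushforward; congr (lebesgue_measure _).
by apply/seteqP; split => x; rewrite /preimage/= !in_itv/= ltrBlDr lerBrDr.
Qed.

Lemma integrable_shift (R : realType) (c : R) (D : set R) (f : R -> R) :
  measurable D -> lebesgue_measure.-integrable D (EFin \o f) ->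
  lebesgue_measure.-integrable [set x | D (x + c)] (fun x => (f (x + c))%:E).
Proof.
move=> mD; have mphi : measurable_fun setT
  ((fun x => x + c) : measurableTypeR R -> measurableTypeR R).
  by apply: measurable_funD.
move=> /integrableP[mf foo].
have mD' : measurable [set x | D (x + c)].
  by rewrite -[X in measurable X]setTI; exact: mphi.
apply/integrableP; split.
  by apply: (measurable_comp mD _ mf) => [_ [x Dx <-//]|]; exact: measurable_funTS.
move: foo; congr (_ < _)%E.
have := @ge0_integral_pushforward _ _ _ _ _ _ mphi lebesgue_measure D (abse \o (EFin \o f)) mD.
rewrite /= => <-//.
  by apply: eq_measure_integral => A mA _; exact/esym/lebesgue_measure_shift.
exact: measurableT_comp.
Qed.

Lemma Rintegral_shift (R : realType) (c : R) (D : set R) (f : R -> R) :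
  measurable D -> lebesgue_measure.-integrable D (EFin \o f) ->
  \int[lebesgue_measure]_(x in [set x | D (x + c)]) f (x + c)
  = \int[lebesgue_measure]_(x in D) f x.
Proof.
move=> mD; have mphi : measurable_fun setT
  ((fun x => x + c) : measurableTypeR R -> measurableTypeR R).
  by apply: measurable_funD.
move=> fi; rewrite /Rintegral; congr fine.
(* Change of variables asks for measurability on the whole line, so [f] is extended by zero outside
   [D]. *)
have mfD : measurable_fun setT (EFin \o f \_ D : measurableTypeR R -> _).
  have /integrableP[mf _] := fi.
  by rewrite -restrict_EFin; exact/(measurable_restrictT _ _).1.
transitivity (\int[lebesgue_measure]_(x in [set x : R | D (x + c)%R])
   ((f \_ D) (x + c)%R)%:E)%E.
  by apply: eq_integral => x; rewrite inE/= => xD; rewrite patchE mem_set.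
have := @integral_pushforward _ _ _ _ _ _ mphi lebesgue_measure D (EFin \o f \_ D) mfD.
rewrite /= => <-//.
- transitivity (\int[lebesgue_measure]_(x in D) (EFin \o f \_ D) x)%E.
    by apply: eq_measure_integral => A mA _; exact: lebesgue_measure_shift.
  by apply: eq_integral => x xD; rewrite /= patchE xD.
- have := @integrable_shift R c D (f \_ D) mD; apply.
  apply: eq_integrable fi => // x xD /=.
  by rewrite patchE xD.
Qed.

Lemma Rintegral_itv_cc_sub {R : realType} {f : R -> R} {c s t : R} :
  lebesgue_measure.-integrable `[0, c] (EFin \o f) -> 0 <= s -> s <= t -> t <= c ->
  \int[lebesgue_measure]_(x in `[0, t]) f x - \int[lebesgue_measure]_(x in `[0, s]) f x
  = \int[lebesgue_measure]_(x in `]s, t]) f x.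
Proof.
move=> fi s0 st tc; rewrite Rintegral_itvB// ?bnd_simp//.
by apply: integrableS fi => //; apply: subset_itvl; rewrite bnd_simp.
Qed.

(** * Record points of a primitive with negative drift *)

(** A maximum point of [F] on [[0, 1]] may lie in [N] and need not be strict. So [F] is perturbed by
    a small increasing function, steep enough on an open set around [N] to outweigh any decrease of
    [F] and thus to keep the maximum out of that set. *)
Lemma drift_record_point {R : realType} {f : R -> R} {N : set R} :
  lebesgue_measure.-integrable `[0, 2] (EFin \o f) ->
  let F t := \int[lebesgue_measure]_(x in `[0, t]) f x in
  (forall s, 0 <= s <= 1 -> F (s + 1) = F s + F 1) -> F 1 < 0 ->
  lebesgue_measure.-negligible N ->
  exists a, [/\ 0 < a < 1, ~ N a & forall b, a < b <= a + 1 -> F b < F a].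
Proof.
move=> fi F Fper F1 Nneg.
have F0 : F 0 = 0 by rewrite /F set_itv1 Rintegral_set1.
(* On [[0, 2]] the perturbation [G t + e * t] will grow by less than [e + 2 * e], which is below
   [- F 1 = 4 * e]. *)
pose e := - F 1 / 4; have e0 : 0 < e by rewrite /e; lra.
(* Absolute continuity of the integral: an open cover of [N] of measure below [d] carries less than
   [e] of the mass of [|f|]. *)
have [d [d0 hd]] : exists d : R, 0 < d /\ forall A, measurable A ->
    (lebesgue_measure A < d%:E)%E ->
    \int[lebesgue_measure]_(x in A) `|(f \_ `[0, 2]) x| < e.
  apply: integral_normr_continuous => //.
  by rewrite -restrict_EFin; apply/integrable_restrict => //=; rewrite setTI.
(* Adding [0] to the null set keeps the maximum point away from the left end, which yields
   [0 < a]. *)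
have [A [mA A0 NA]] : lebesgue_measure.-negligible (N `|` [set 0]).
  apply: negligibleU => //; apply/negligibleP; first exact: measurable_set1.
  exact: lebesgue_measure_set1.
have {}A0 : (lebesgue_measure : set R -> \bar R) A = 0%E := A0.
have muA : ((lebesgue_measure : set R -> \bar R) A < +oo)%E.
  by rewrite A0 ltry.
have [U [oU AU UA]] := @lebesgue_regularity_outer R A d mA muA d0.
have mU : measurable U by exact: open_measurable.
have Ud : (lebesgue_measure U < d%:E)%E.
  have -> : U = (U `\` A) `|` A by rewrite setUC setDUK.
  rewrite (le_lt_trans (measureU2 _ _ _))//; first exact: measurableD.
  by rewrite [X in (_ + X < _)%E]A0 adde0.
pose g := (fun x => `|f x|) \_ U.
have gi : lebesgue_measure.-integrable `[0, 2] (EFin \o g).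
  rewrite /g -restrict_EFin; apply/integrable_restrict => //=.
  apply: integrableS (integrable_norm fi) => //; exact: measurableI.
have g0 x : 0 <= g x by rewrite /g patchE; case: ifP.
pose G t := \int[lebesgue_measure]_(x in `[0, t]) g x.
have G2 : G 2 < e.
  apply: le_lt_trans (hd U mU Ud); rewrite le_eqVlt; apply/orP; left; apply/eqP.
  rewrite /G -Rintegral_mkcondr setIC Rintegral_mkcondr.
  by apply: eq_Rintegral => x _; rewrite !patchE; case: ifP => // _; rewrite normr0.
have incr (h : R -> R) (s t : R) : lebesgue_measure.-integrable `[0, 2] (EFin \o h) ->
    0 <= s -> s <= t -> t <= 2 -> (forall x, s < x <= t -> 0 <= h x) ->
    \int[lebesgue_measure]_(x in `[0, s]) h x <=
    \int[lebesgue_measure]_(x in `[0, t]) h x.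
  move=> hi s0 st t2 h0; rewrite -subr_ge0 (Rintegral_itv_cc_sub hi)//.
  by apply: Rintegral_ge0 => x /=; rewrite in_itv/=; exact: h0.
have Gmono (s t : R) : 0 <= s -> s <= t -> t <= 2 -> G s <= G t.
  by move=> *; exact: incr.
have G0 : G 0 = 0 by rewrite /G set_itv1 Rintegral_set1.
have FG (t : R) : 0 <= t <= 2 -> F t + G t = \int[lebesgue_measure]_(x in `[0, t]) (f x + g x).
  move=> /andP[t0 t2]; have sub : `[0, t] `<=` `[0, 2] by apply: subset_itvl; rewrite bnd_simp.
  by rewrite RintegralD//; [exact: integrableS fi|exact: integrableS gi].
(* [H - F] is strictly increasing and grows by less than [- F 1] on [[0, 2]],
   so [F b < F a] for [b > a] at a maximum point [a] of [H] on [[0, 1]]; such an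
   [a] is not in [U], where [f + g >= 0] makes [H] strictly increasing. *)
pose H (t : R) := F t + G t + e * t.
have cH : {within `[0, 2], continuous H}.
  have c1 := @parameterized_integral_continuous R 0 2 f ltac:(lra) fi.
  have c2 := @parameterized_integral_continuous R 0 2 g ltac:(lra) gi.
  move=> x; apply: cvgD; first by apply: cvgD; [exact: c1|exact: c2].
  apply: cvgMr; apply: continuous_subspaceT => ?; exact: cvg_id.
have {}cH : {within `[0, 1], continuous H}.
  by apply: continuous_subspaceW cH; apply: subset_itvl; rewrite bnd_simp; lra.
have [a /[!in_itv]/= /andP[a0 a1] amax] := @EVT_max R H 0 1 ler01 cH.
have {}amax (t : R) : 0 <= t <= 1 -> H t <= H a.
  by move=> t01; apply: amax; rewrite in_itv.
have H0 : H 0 = 0 by rewrite /H F0 G0; ring.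
(* Since [H 0 = 0], this excludes [1] as a maximum point and leaves room to the right of [a] inside
   [[0, 1]]. *)
have H1 : H 1 < 0.
  have := Gmono 1 2; rewrite /H /e in G2 *; lra.
have {}a1 : a < 1.
  rewrite lt_neqAle a1 andbT; apply/eqP => aE.
  have := amax 0; rewrite lexx ler01 => /(_ isT); rewrite H0 aE; lra.
have aU : ~ U a.
  move=> Ua.
  have /nbhs_ballP[r /= r0 rU] : nbhs a U by exact: open_nbhs_nbhs.
  pose t := a + Num.min (r / 2) (1 - a).
  have r'0 : 0 < Num.min (r / 2) (1 - a) by rewrite lt_min divr_gt0//= subr_gt0.
  have tr : t <= a + r / 2 by rewrite lerD2l ge_min lexx.
  have t1 : t <= 1 by rewrite -lerBrDl ge_min lexx orbT.
  have at_ : a < t by rewrite ltrDl.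
  have : H t <= H a by apply: amax; lra.
  have : F a + G a <= F t + G t.
    rewrite !FG; [|lra..].
    apply: incr => //; [|lra..|].
      by apply: integrableD fi gi => //; exact: measurable_itv.
    move=> x /andP[ax xt]; rewrite /g patchE mem_set.
      by have := ler_norm (- f x); rewrite normrN; lra.
    by apply: rU; rewrite /ball/= ltr0_norm; lra.
  have : 0 < e * (t - a) by rewrite mulr_gt0// subr_gt0.
  rewrite /H; lra.
exists a; split.
- rewrite a1 andbT lt_neqAle a0 andbT; apply/eqP => aE; apply: aU; apply: AU.
  by apply: NA; right.
- by move=> Na; apply/aU/AU/NA; left.
- move=> b /andP[ab ba].
  have [b1|b1] := leP b 1.
    have := amax b; have := Gmono a b; rewrite /H.
    have : 0 < e * (b - a) by rewrite mulr_gt0// subr_gt0.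
    lra.
  (* Beyond [1], maximality is used at [b - 1]; the drift [F 1 = - 4 * e] outweighs [G a + e * a],
     which is below [2 * e]. *)
  have /amax : 0 <= b - 1 <= 1 by lra.
  have := Fper (b - 1); rewrite subrK => ->; last by lra.
  have := Gmono 0 (b - 1); have := Gmono a 2; rewrite /H /e in G2 *.
  have : 0 <= e * (b - 1) by rewrite mulr_ge0//; lra.
  have : 0 < e * (1 - a) by rewrite mulr_gt0//; lra.
  rewrite /e; lra.
Qed.

(** * Sums and periodic integrands *)

Lemma Rintegral_sum (R : realType) (I : Type) (s : seq I) (D : set R) (h : I -> R -> R) :
  measurable D -> (forall i, lebesgue_measure.-integrable D (EFin \o h i)) ->
  lebesgue_measure.-integrable D (EFin \o (fun x => \sum_(i <- s) h i x)) /\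
  \int[lebesgue_measure]_(x in D) (\sum_(i <- s) h i x) =
  \sum_(i <- s) \int[lebesgue_measure]_(x in D) h i x.
Proof.
move=> mD hi; elim: s => [|i s [IHi IH]].
  have -> : (fun x => \sum_(i <- [::]) h i x) = (fun=> 0).
    by apply/funext => x; rewrite big_nil.
  split; first exact: integrable0.
  by rewrite big_nil /Rintegral integral0.
have -> : (fun x => \sum_(j <- i :: s) h j x) = (fun x => h i x + \sum_(j <- s) h j x).
  by apply/funext => x; rewrite big_cons.
split; first by apply: integrableD (hi i) IHi.
by rewrite big_cons -IH RintegralD.
Qed.

(** The range [[0, 2]] accommodates every window of length at most [1] that starts in [[0, 1]]. *)
Lemma periodic_integrable {R : realType} {g : R -> R} :
  (forall x, g (x + 1) = g x) -> lebesgue_measure.-integrable `[0, 1] (EFin \o g) ->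
  lebesgue_measure.-integrable `[0, 2] (EFin \o g).
Proof.
move=> per gi.
have gE : g = (fun x => g (x - 1)) by apply/funext => x; rewrite -[RHS]per subrK.
have gi' : lebesgue_measure.-integrable `]1, 2] (EFin \o g).
  have -> : `]1, 2]%classic = [set x : R | `]0, 1]%classic (x - 1)].
    by apply/seteqP; split => x /=; rewrite !in_itv/=; lra.
  rewrite gE; apply: integrable_shift => //.
  by apply: integrableS gi => //; apply: subset_itvr; rewrite bnd_simp.
have -> : `[0, 2]%classic = `[0, 1]%classic `|` `]1, 2]%classic :> set R.
  by rewrite -itv_bndbnd_setU// bnd_simp; lra.
move: gi gi' => /integrableP[m1 i1] /integrableP[m2 i2].
have mg : measurable_fun (`[0, 1]%classic `|` `]1, 2]%classic : set (measurableTypeR R))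
  (EFin \o g) by apply/measurable_funU.
have mag := measurableT_comp (@abse_measurable R setT) mg.
apply/integrableP; split => //.
have -> := ge0_integral_setU lebesgue_measure _ _ mag.
- exact: lte_add_pinfty.
- exact: measurable_itv.
- exact: measurable_itv.
- by move=> x _; exact: abse_ge0.
- by apply/disj_setPS => x [/=]; rewrite !in_itv/=; lra.
Qed.

Lemma periodic_Rintegral (R : realType) (g : R -> R) (s : R) :
  (forall x, g (x + 1) = g x) -> lebesgue_measure.-integrable `[0, 1] (EFin \o g) ->
  0 <= s <= 1 ->
  \int[lebesgue_measure]_(x in `[0, s + 1]) g x =
  \int[lebesgue_measure]_(x in `[0, s]) g x + \int[lebesgue_measure]_(x in `[0, 1]) g x.
Proof.
move=> per gi /andP[s0 s1].
have gE : g = (fun x => g (x - 1)) by apply/funext => x; rewrite -[RHS]per subrK.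
have gi2 := periodic_integrable per gi.
apply/eqP; rewrite -subr_eq; apply/eqP.
rewrite (Rintegral_itv_cc_sub gi2)//; [|lra..].
have -> : `]1, s + 1]%classic = [set x : R | `]0, s]%classic (x - 1)].
  by apply/seteqP; split => x /=; rewrite !in_itv/=; lra.
have gis : lebesgue_measure.-integrable `[0, s] (EFin \o g).
  by apply: integrableS gi => //; apply: subset_itvl; rewrite bnd_simp.
have gis' : lebesgue_measure.-integrable `]0, s] (EFin \o g).
  by apply: integrableS gis => //; apply: subset_itvr; rewrite bnd_simp.
rewrite {1}gE Rintegral_shift//.
by rewrite Rintegral_itv_obnd_cbnd.
Qed.

(** * Differentiation almost everywhere *)

(** This is Lebesgue differentiation, restricted to right slopes because the windows shrink to their
    left end. *)
Lemma ae_cvg_right_slope (R : realType) (c : R) (g : R -> R) :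
  lebesgue_measure.-integrable `[0, c] (EFin \o g) ->
  {ae lebesgue_measure, forall x : R, 0 < x < c ->
    h^-1 * (\int[lebesgue_measure]_(t in `[0, x + h]) g t
            - \int[lebesgue_measure]_(t in `[0, x]) g t) @[h --> 0^'+] --> g x}.
Proof.
(* Extension by zero makes the integrand integrable on the whole line; the primitives agree up to
   [c], and [x < c] leaves room for small [h]. *)
move=> gi; pose g' := g \_ `[0, c].
have g'i y : lebesgue_measure.-integrable `[0, y] (EFin \o g').
  rewrite /g' -restrict_EFin; apply/integrable_restrict => //=.
  by apply: integrableS gi => //; exact: measurableI.
have loc : locally_integrable setT g' by exact: integrable_locally.
pose F' (y : R) := \int[lebesgue_measure]_(t in `[0, y]) g' t.
have FE y : y <= c -> F' y = \int[lebesgue_measure]_(t in `[0, y]) g t.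
  move=> yc; apply: eq_Rintegral => t; rewrite inE/= in_itv/= => /andP[t0 ty].
  by rewrite /g' patchE mem_set//= in_itv/= t0 (le_trans ty).
have := FTC1 g'i loc.
apply: filterS; first exact: (ae_filter_ringOfSetsType (@lebesgue_measure R)).
rewrite -/F' => x Hx /andP[x0 xc]; have [|dF] := Hx; first by rewrite lte_fin.
have -> : g' x = g x by rewrite /g' patchE mem_set//= in_itv/= (ltW x0) ltW.
rewrite derive1E => <-.
have {}dF : h^-1 *: (F' (h *: 1 + x) - F' x) @[h --> 0^'] --> 'D_1 F' x := dF.
move/cvg_dnbhs_at_right : dF; apply: cvg_trans; apply: near_eq_cvg; near=> h.
rewrite (FE x) ?ltW// FE.
  by rewrite /GRing.scale/= mulr1 (addrC h x).
rewrite /GRing.scale/= mulr1 -lerBrDr; near: h.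
by apply: nbhs_right_le; rewrite subr_gt0.
Unshelve. all: by end_near. Qed.

(** * Connectedness, convergence and half-spaces *)

(** The trace of the interior of [C] on [K] is open in [K]; it is also closed in [K], being equal to
    the trace of the closure of [C]. *)
Lemma connected_subset_interior (T : topologicalType) (K C : set T) :
  connected K -> K `&` C° !=set0 -> K `&` (closure C `\` C°) = set0 -> K `<=` C°.
Proof.
move=> cK K0 KC; suff -> : K = K `&` C° by move=> x [].
apply/esym/cK => //; first by exists C° => //; exact: open_interior.
exists (closure C); first exact: closed_closure.
apply/seteqP; split => x [Kx Cx]; split => //.
  exact: (subset_closure (interior_subset Cx)).
by apply: contrapT => nCx; suff : set0 x by []; rewrite -KC.
Qed.

Lemma cvg_rV (R : realType) (d : nat) (T : Type) (F : set_system T) (FF : Filter F)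
  (f : T -> 'rV[R]_d) (l : 'rV[R]_d) :
  (forall i, f x ord0 i @[x --> F] --> l ord0 i) -> f x @[x --> F] --> l.
Proof.
move=> fl A [P lP PA]; rewrite /nbhs/=.
have : F [set x | forall i j, P i j (f x i j)].
  apply: filter_forall => i; apply: filter_forall => j.
  by rewrite (ord1 i); exact: (fl j _ (lP ord0 j)).
by apply: filterS => x Px; exact: PA.
Qed.

(** From an interior point a short move along [n] stays in [A] and raises the functional by a
    positive multiple of [dotv n n]. *)
Lemma dotv_interior_lt (R : realType) (d : nat) (A : set 'rV[R]_d) (n x : 'rV[R]_d) (c : R) :
  n != 0 -> A `<=` [set y | dotv n y <= c] -> A° x -> dotv n x < c.
Proof.
move=> n0 Ac Ax.
have nn : 0 < dotv n n.
  rewrite lt_neqAle sumr_ge0 ?andbT; last by move=> i _; rewrite -expr2 sqr_ge0.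
  apply: contra_neq n0 => /esym/eqP; rewrite psumr_eq0.
    move=> /allP n0; apply/rowP => i; apply/eqP.
    by have := n0 i; rewrite mem_index_enum mulf_eq0 orbb mxE => /(_ isT).
  by move=> i _; rewrite -expr2 sqr_ge0.
have : \forall t \near 0^'+, A (x + t *: n).
  have : x + t *: n @[t --> 0^'+] --> x.
    rewrite -[X in _ --> X]addr0 -(scale0r n).
    apply: cvgD; first exact: cvg_cst.
    by apply: cvgZr_tmp; apply: cvg_at_right_filter; exact: cvg_id.
  exact.
move=> At; near (0 : R)^'+ => t.
have /Ac /= : A (x + t *: n) by near: t.
have -> : dotv n (x + t *: n) = dotv n x + t * dotv n n.
  rewrite /dotv mulr_sumr -big_split; apply: eq_bigr => i _ /=.
  by rewrite !mxE; ring.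
have : 0 < t * dotv n n by rewrite mulr_gt0.
lra.
Unshelve. all: by end_near. Qed.

(** Segments from [x] to the points of a ball inside [U] are connected and stay in that ball. *)
Lemma open_component_interior (R : realType) (d : nat) (U : set 'rV[R]_d) (x : 'rV[R]_d) :
  open U -> U x -> (connected_component U x)° x.
Proof.
move=> oU Ux.
have /nbhs_ballP[r /= r0 rU] : nbhs x U by exact: open_nbhs_nbhs.
apply/nbhs_ballP; exists r => //= y xy.
pose s := (fun t : R => x + t *: (y - x)) @` `[0, 1].
have s1 : s y by exists 1; rewrite /= ?in_itv/= ?ler01 ?lexx// scale1r addrC subrK.
suff : s `<=` connected_component U x by exact.
apply: connected_component_max.
- by exists 0; rewrite /= ?in_itv/= ?ler01 ?lexx// scale0r addr0.
- move=> _ [t /=] /[!in_itv]/= /andP[t0 t1] <-; apply: rU.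
  rewrite -ball_normE/= opprD addrA subrr sub0r normrN normrZ ger0_norm//.
  move: xy; rewrite -ball_normE/= distrC; apply: le_lt_trans.
  by rewrite ler_piMl.
- apply: connected_continuous_connected; first exact: segment_connected.
  apply: continuous_subspaceT => t.
  by apply: cvgD; [exact: cvg_cst|apply: cvgZr_tmp; exact: cvg_id].
Qed.

(** * Window means as slopes of primitives *)

(** With means written as difference quotients, continuity, periodicity and differentiability of the
    primitive carry over to them. *)
Lemma torus_avg_slope (R : realType) (d : nat) (psi : R -> 'rV[R]_d) (a b : R) (i : 'I_d) :
  L1_torus psi -> 0 <= a -> a <= b -> b <= 2 ->
  avg psi a b ord0 i =
  (b - a)^-1 * (\int[lebesgue_measure]_(x in `[0, b]) psi x ord0 i
              - \int[lebesgue_measure]_(x in `[0, a]) psi x ord0 i).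
Proof.
move=> [per psii] a0 ab b2; rewrite mxE; congr (_ * _).
have i2 : lebesgue_measure.-integrable `[0, 2] (EFin \o (fun x => psi x ord0 i)).
  by apply: periodic_integrable => [x|]; [rewrite per|exact: psii].
rewrite (Rintegral_itv_cc_sub i2)// Rintegral_itv_obnd_cbnd//.
by apply: integrableS i2 => //; apply: subset_itv; rewrite bnd_simp.
Qed.

Lemma Rintegral_dotv (R : realType) (d : nat) (psi : R -> 'rV[R]_d) (n : 'rV[R]_d) (c t : R) :
  0 <= t ->
  (forall i, lebesgue_measure.-integrable `[0, t] (EFin \o (fun x => psi x ord0 i))) ->
  lebesgue_measure.-integrable `[0, t] (EFin \o (fun x => dotv n (psi x) - c)) /\
  \int[lebesgue_measure]_(x in `[0, t]) (dotv n (psi x) - c) =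
  \sum_i n ord0 i * \int[lebesgue_measure]_(x in `[0, t]) psi x ord0 i - c * t.
Proof.
move=> t0 psii.
have npi i : lebesgue_measure.-integrable `[0, t]
    (EFin \o (fun x => n ord0 i * psi x ord0 i)).
  by apply: integrableZl (psii i) => //; exact: measurable_itv.
have [si sE] := @Rintegral_sum R 'I_d (index_enum 'I_d) `[0, t]%classic
  (fun i x => n ord0 i * psi x ord0 i) (measurable_itv _) npi.
have ci : lebesgue_measure.-integrable `[0, t] (EFin \o cst c).
  apply: measurable_bounded_integrable => //=.
  - by rewrite lebesgue_measure_itv/=; case: ifP => // _; rewrite ltry.
  - by exists `|c|; split; [exact: num_real|move=> M cM x _ /=; exact: ltW].
split; first by apply: integrableB si ci => //; exact: measurable_itv.
rewrite RintegralB//.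
rewrite (sE : \int[lebesgue_measure]_(x in `[0, t]) dotv n (psi x) = _).
congr (_ - _).
  by apply: eq_bigr => i _; rewrite RintegralZl.
rewrite Rintegral_cst//; congr (_ * _).
suff : lebesgue_measure (`[0, t]%classic : set R) = t%:E by move=> /(congr1 fine).
rewrite lebesgue_measure_itv/= lte_fin sube0.
by case: ltgtP t0 => // <-.
Qed.

(** * The mean over a period *)

Theorem theorem1 (R : realType) (d : nat) (OmO OmI : set 'rV[R]_d) :
  (0 < d)%N ->
  standing_assumptions OmO OmI ->
  forall psi : R -> 'rV[R]_d, A_circ OmO OmI psi ->
  ~ (chull OmI)° (avg psi 0 1).
Proof.
move=> _ [[_ Oo _ Icl _] [_ hullO _ _ comp]] psi [psiL1 psibd psiI] x0in.
set x0 := avg psi 0 1 in x0in.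
pose U := (chull OmI)° `\` OmI.
have oU : open U by apply: openI; [exact: open_interior|exact: closed_openC].
have Ux0 : U x0 by split => //; exact: psiI.
pose C := connected_component U x0.
have Cx0 : C° x0 by exact: open_component_interior.
have [L [[n [c [n0 LE hullc _]]] CL]] := comp C (ex_intro2 _ _ x0 Ux0 erefl).
have x0c : dotv n x0 < c by exact: dotv_interior_lt x0in.
have [per psi1] := psiL1.
have psi2 i : lebesgue_measure.-integrable `[0, 2] (EFin \o (fun x => psi x ord0 i)).
  by apply: periodic_integrable => [x|]; [rewrite per|exact: psi1].
pose f x := dotv n (psi x) - c.
pose I (i : 'I_d) (t : R) := \int[lebesgue_measure]_(x in `[0, t]) psi x ord0 i.
have fE t : 0 <= t <= 2 -> \int[lebesgue_measure]_(x in `[0, t]) f x =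
    \sum_i n ord0 i * I i t - c * t.
  move=> /andP[t0 t2]; apply: (Rintegral_dotv _ _ _ _ _ _ t0 _).2 => i.
  by apply: integrableS (psi2 i) => //; apply: subset_itvl; rewrite bnd_simp.
have fi : lebesgue_measure.-integrable `[0, 2] (EFin \o f).
  exact: (Rintegral_dotv _ _ _ _ _ _ _ psi2).1.
have avgE a b i : 0 <= a -> a <= b -> b <= 2 ->
    avg psi a b ord0 i = (b - a)^-1 * (I i b - I i a).
  by move=> *; exact: torus_avg_slope.
have I1 i : I i 1 = x0 ord0 i by rewrite mxE subr0 invr1 mul1r.
have Iper i s : 0 <= s <= 1 -> I i (s + 1) = I i s + I i 1.
  by move=> s01; apply: (periodic_Rintegral _ (fun x => psi x ord0 i)) => [x||//];
    [rewrite per|exact: psi1].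
(* The sign of the increment of the primitive of [f] tells on which side of the hyperplane the mean
   over [[a, b]] lies. *)
have dot_avg a b : 0 <= a -> a < b -> b <= 2 -> dotv n (avg psi a b) - c =
    (b - a)^-1 * (\int[lebesgue_measure]_(x in `[0, b]) f x
                  - \int[lebesgue_measure]_(x in `[0, a]) f x).
  move=> a0 ab b2; rewrite !fE; [|lra..].
  have -> : dotv n (avg psi a b) =
      (b - a)^-1 * (\sum_i n ord0 i * I i b - \sum_i n ord0 i * I i a).
    rewrite -sumrB mulr_sumr; apply: eq_bigr => i _.
    by rewrite (avgE a b i a0 (ltW ab) b2) mulrCA mulrBr.
  by field; rewrite subr_eq0 gt_eqF.
have Fper s : 0 <= s <= 1 -> \int[lebesgue_measure]_(x in `[0, s + 1]) f x =
    \int[lebesgue_measure]_(x in `[0, s]) f x + \int[lebesgue_measure]_(x in `[0, 1]) f x.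
  move=> s01; rewrite !fE; [|lra..].
  under eq_bigr do rewrite Iper// mulrDr.
  by rewrite big_split/=; ring.
have F1 : \int[lebesgue_measure]_(x in `[0, 1]) f x < 0.
  rewrite fE ?mulr1; last by lra.
  by under eq_bigr do rewrite I1; rewrite subr_lt0.
(* Outside [N], all coordinates of the means over [[x, x + h]] converge to those of [psi x];
   finitely many null sets make up [N]. *)
pose N := ~` [set x : R | forall i, 0 < x < 2 ->
    h^-1 * (I i (x + h) - I i x) @[h --> 0^'+] --> psi x ord0 i].
have Nneg : lebesgue_measure.-negligible N.
  apply: (@filter_forall _ _ _ _ (ae_filter_ringOfSetsType (@lebesgue_measure R))) => i.
  exact: ae_cvg_right_slope.
have [a [/andP[a0 a1] aN adec]] := drift_record_point fi Fper F1 Nneg.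
(* The end [a] is left out: since [0^-1 = 0], the value [avg psi a a] is the zero vector and not the
   limit of the means. *)
pose K := avg psi a @` `]a, a + 1].
have avga1 : avg psi a (a + 1) = x0.
  apply/rowP => i; rewrite avgE; [|lra..].
  rewrite Iper ?I1; last by lra.
  by rewrite [a + 1]addrC addrK invr1 mul1r [I i a + _]addrC addrK.
have cK : connected K.
  apply: connected_continuous_connected.
    by apply/connected_intervalP; exact: interval_is_interval.
  apply/subspace_continuousP => b /=; rewrite in_itv/= => /andP[ab ba].
  apply: cvg_rV => i.
  have cI : {within `]a, a + 1], continuous (I i)}.
    have cI := @parameterized_integral_continuous R 0 2 _ ltac:(lra) (psi2 i).
    by apply: continuous_subspaceW cI; apply: subset_itv; rewrite bnd_simp; lra.
  have /subspace_continuousP cIb := cI.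
  rewrite avgE; [|lra..].
  have : (y - a)^-1 * (I i y - I i a) @[y --> within `]a, a + 1] (nbhs b)] -->
      (b - a)^-1 * (I i b - I i a).
    apply: cvgM; last first.
      by apply: cvgB; [apply: cIb; rewrite /= in_itv/= ab|exact: cvg_cst].
    apply: cvgV; first by rewrite subr_eq0 gt_eqF.
    by apply: cvgB; [exact: cvg_within_filter|exact: cvg_cst].
  apply: cvg_trans; apply: near_eq_cvg; rewrite near_withinE; apply: nearW => y.
  by rewrite /= in_itv/= => /andP[ay ya]; rewrite avgE//; lra.
have KC : K `<=` C°.
  apply: connected_subset_interior => //.
    exists x0; split => //; exists (a + 1) => //=; rewrite in_itv/=; lra.
  (* A mean on the boundary of [C] would avoid [OmI] and hence lie on [L]; the primitive of [f]
     would then take equal values at [a] and [b], against [adec]. *)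
  apply/seteqP; split => // x [[b /= + <-{x}] bC]; rewrite in_itv/= => ab.
  have : L (avg psi a b).
    by apply: CL; split => //; apply: psiI; lra.
  rewrite LE /= => /eqP; rewrite -subr_eq0 dot_avg; [|lra..].
  rewrite mulf_eq0 invr_eq0 !subr_eq0; have := adec _ ab; lra.
have : closure (chull OmI) (psi a).
  apply: (@closed_cvg _ _ (0^'+) _ (fun h => avg psi a (a + h))).
  - exact: closed_closure.
  - near=> h; apply: subset_closure.
    suff : C° (avg psi a (a + h)).
      by move=> /interior_subset/connected_component_sub[/interior_subset].
    apply: KC; exists (a + h) => //=; rewrite in_itv/= ltrDl lerD2l.
    by apply/andP; split => //; near: h; exact: nbhs_right_le.
  - apply: cvg_rV => i.
    have : h^-1 * (I i (a + h) - I i a) @[h --> 0^'+] --> psi a ord0 i.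
      by move: aN => /contrapT; apply; lra.
    apply: cvg_trans; apply: near_eq_cvg; near=> h.
    rewrite avgE ?[_ - a]addrAC ?subrr ?add0r//; try lra.
    + by rewrite lerDl.
    + have : h <= 1 by near: h; exact: nbhs_right_le. lra.
move=> /hullO; have [_] := psibd a; move: Oo => /interior_id -> //.
Unshelve. all: by end_near. Qed.
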